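(* Let $b,\sigma,r$ satisfy the conditions (i)--(v) listed in the context, fix $c>0$, and let $\phi,\psi$ and $\tilde\phi,\tilde\psi$ be the functions described in the context, spanning the solution spaces of the homogeneous ODEs $\mathcal L_Xw(x)=0$ and $\mathcal L_Yu(x)=0$ on $]0,\infty[$, respectively. Then $$\tilde\phi(x)=\frac{1}{\phi'(c)}\,\phi'(x)\quad\text{and}\quad\tilde\psi(x)=\frac{1}{\psi'(c)}\,\psi'(x),\qquad\text{for all }x>0 .$$ Also, both $\phi$ and $\psi$ are convex, and, if $C:=\psi'(c)-\phi'(c)$ and $\tilde C:=\tilde\psi'(c)-\tilde\phi'(c)$, then $$\tilde C=-\frac{2r(c)}{\sigma^2(c)}\,\frac{1}{\phi'(c)\psi'(c)}\,C .$$
   Context: Let $W$ be a standard one-dimensional Brownian motion on a filtered probability space satisfying the usual conditions, and let $b,\sigma:\,]0,\infty[\,\to\mathbb R$, $r:\,]0,\infty[\,\to\mathbb R_+$. Notation. $$\mu(x)=b(x)+\sigma(x)\sigma'(x)-\tfrac12\sigma^2(x)\frac{r'(x)}{r(x)},\qquad \rho(x)=\frac{r^2(x)-r(x)b'(x)+r'(x)b(x)}{r(x)},$$ $$\mathcal L_Xw=\tfrac12\sigma^2w''+bw'-rw,\qquad \mathcal L_Yu=\tfrac12\sigma^2u''+\mu u'-\rho u .$$ Conditions. (i) $b,\sigma$ are $C^1$, $\sigma'$ is locally Lipschitz, and $\sigma^2(x)>0$ for all $x>0$. (ii) The solution of $dX^0_t=b(X^0_t)\,dt+\sigma(X^0_t)\,dW_t$,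 $X^0_0=x>0$, is non-explosive (it stays in $]0,\infty[$ for all $t\ge0$, a.s.). (iii) $r$ is $C^1$, $r'$ is locally Lipschitz, and there is a constant $r_0>0$ with $r(x)\ge r_0$ for all $x>0$. (iv) The solution of $dY^0_t=\mu(Y^0_t)\,dt+\sigma(Y^0_t)\,dW_t$, $Y^0_0=x>0$, is non-explosive (it stays in $]0,\infty[$ for all $t\ge0$, a.s.). (v) $\rho(x)\ge r_0$ for all $x>0$. The functions $\phi,\psi$: under these conditions the solution space of $\mathcal L_Xw=0$ is spanned by $C^2$ functions $\phi,\psi$ such that $\phi>0$, $\phi'<0$, $\psi>0$, $\psi'>0$ on $]0,\infty[$, $\lim_{x\downarrow0}\phi(x)=\lim_{x\to\infty}\psi(x)=\infty$, and $\phi(c)=\psi(c)=1$; these are unique. The functions $\tilde\phi,\tilde\psi$: likewise, the solution space of $\mathcal L_Yu=0$ is spanned by $C^2$ functions $\tilde\phi,\tilde\psi$ such that $\tilde\phi>0$, $\tilde\phi'<0$, $\tilde\psi>0$, $\tilde\psi'>0$ on $]0,\infty[$, $\lim_{x\downarrow0}\tilde\phi(x)=\lim_{x\to\infty}\tilde\psi(x)=\infty$, and $\tilde\phi(c)=\tilde\psi(c)=1$; these are unique. *)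

(* Defs.v *)
From HB Require Import structures.
From mathcomp Require Import all_boot all_order all_algebra.
From mathcomp Require Import all_classical all_reals all_analysis.

Set Implicit Arguments.
Unset Strict Implicit.
Unset Printing Implicit Defensive.

Import Order.TTheory GRing.Theory Num.Theory.
Import numFieldNormedType.Exports.

Local Open Scope classical_set_scope.
Local Open Scope ring_scope.

(** Functions on the half-line ]0, +oo[ are total functions R -> R of which only
    the values at positive points matter; a derivative at x > 0 depends only on
    the values near x, so differentiating the total function is harmless. *)

Section smoothness.
Context {R : realType}.
Implicit Type f : R -> R.

Definition C1_pos f : Prop :=
  forall x : R, 0 < x -> derivable f x 1 /\ {for x, continuous (derive1 f)}.

Definition C2_pos f : Prop := C1_pos f /\ C1_pos (derive1 f).

Definition locally_lipschitz_pos f : Prop :=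
  forall x : R, 0 < x -> exists2 U : set R, nbhs x U & [lipschitz f y | y in U].

End smoothness.

Section ode.
Context {R : realType}.
Implicit Types a b sigma r w phi psi : R -> R.

(** [Lop b sigma r] is L_X; [Lop (mu_Y b sigma r) sigma (rho_Y b r)] is L_Y. *)
Definition Lop b sigma r w (x : R) : R :=
  2^-1 * sigma x ^+ 2 * derive1 (derive1 w) x + b x * derive1 w x - r x * w x.

Definition mu_Y b sigma r (x : R) : R :=
  b x + sigma x * derive1 sigma x - 2^-1 * sigma x ^+ 2 * (derive1 r x / r x).

Definition rho_Y b r (x : R) : R :=
  (r x ^+ 2 - r x * derive1 b x + derive1 r x * b x) / r x.

Definition Lop_solution b sigma r w : Prop :=
  C2_pos w /\ forall x : R, 0 < x -> Lop b sigma r w x = 0.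

(** The normalised decreasing (phi) and increasing (psi) functions spanning the
    solution space of [Lop b sigma r w = 0] on ]0, +oo[. *)
Record fundamental_pair b sigma r (c : R) phi psi : Prop := FundamentalPair {
  fp_phi_solution : Lop_solution b sigma r phi ;
  fp_psi_solution : Lop_solution b sigma r psi ;
  fp_span : forall w, Lop_solution b sigma r w ->
    exists A B : R, forall x : R, 0 < x -> w x = A * phi x + B * psi x ;
  fp_phi_gt0 : forall x : R, 0 < x -> 0 < phi x ;
  fp_dphi_lt0 : forall x : R, 0 < x -> derive1 phi x < 0 ;
  fp_psi_gt0 : forall x : R, 0 < x -> 0 < psi x ;
  fp_dpsi_gt0 : forall x : R, 0 < x -> 0 < derive1 psi x ;
  fp_phi_cvg : phi x @[x --> 0^'+] --> +oo ;
  fp_psi_cvg : psi x @[x --> +oo] --> +oo ;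
  fp_phi_c : phi c = 1 ;
  fp_psi_c : psi c = 1
}.

End ode.

Section stochastic.
Context {R : realType} {d : measure_display} {Omega : measurableType d}.
Variable P : probability Omega R.
Implicit Types (F : R -> set (set Omega)) (X W H : R -> Omega -> R).

(** Only times t >= 0 are relevant. *)
Record filtration_usual_conditions F : Prop := FiltrationUsualConditions {
  filt_sigma_algebra : forall t : R, 0 <= t -> sigma_algebra setT (F t) ;
  filt_measurable : forall (t : R) A, 0 <= t -> F t A -> measurable A ;
  filt_monotone : forall s t : R, 0 <= s -> s <= t -> F s `<=` F t ;
  filt_right_continuous : forall t : R, 0 <= t ->
    \bigcap_(s in [set s | t < s]) F s = F t ;
  filt_complete : forall N, P.-negligible N -> F 0 N
}.

Definition measurable_wrt (G : set (set Omega)) (Z : Omega -> R) : Prop :=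
  forall B : set (measurableTypeR R), measurable B -> G (Z @^-1` B).

Definition adapted F X : Prop := forall t : R, 0 <= t -> measurable_wrt (F t) (X t).

Definition ae_continuous_paths X : Prop :=
  {ae P, forall w, {within `[0, +oo[, continuous (X ^~ w)}}.

Definition increment W (s t : R) : Omega -> R := fun w => W t w - W s w.

(** Standard Brownian motion relative to the filtration F; the second argument
    of [normal_prob] is the standard deviation. *)
Record brownian_motion F W : Prop := BrownianMotion {
  bm_adapted : adapted F W ;
  bm_start : {ae P, forall w, W 0 w = 0} ;
  bm_continuous : ae_continuous_paths W ;
  bm_gaussian : forall s t : R, 0 <= s -> s < t ->
    forall B : set (measurableTypeR R), measurable B ->
    P (increment W s t @^-1` B) = normal_prob 0 (Num.sqrt (t - s)) B ;
  bm_independent : forall s t : R, 0 <= s -> s < t ->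
    forall (A : set Omega) (B : set (measurableTypeR R)),
    F s A -> measurable B ->
    P (A `&` increment W s t @^-1` B) = (P A * P (increment W s t @^-1` B))%E
}.

(** Simple integrand on [0, t]: value [sp_val k] on the interval
    [sp_knot k, sp_knot k.+1[, for k < sp_size. *)
Record simple_process F (t : R) := SimpleProcess {
  sp_size : nat ;
  sp_knot : nat -> R ;
  sp_val : nat -> Omega -> R ;
  sp_knot0 : sp_knot 0%N = 0 ;
  sp_knot_last : sp_knot sp_size = t ;
  sp_knot_le : forall k, (k < sp_size)%N -> sp_knot k <= sp_knot k.+1 ;
  sp_val_measurable : forall k, (k < sp_size)%N ->
    measurable_wrt (F (sp_knot k)) (sp_val k) ;
  sp_val_bounded : exists M : R, forall k w, (k < sp_size)%N -> `|sp_val k w| <= M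
}.

Definition simple_process_fun F t (K : simple_process F t) : R -> Omega -> R :=
  fun s w => \sum_(k < sp_size K)
    sp_val K k w * \1_(`[sp_knot K k, sp_knot K k.+1[%classic) s.

Definition simple_integral F t (K : simple_process F t) W : Omega -> R :=
  fun w => \sum_(k < sp_size K)
    sp_val K k w * (W (sp_knot K k.+1) w - W (sp_knot K k) w).

(** Convergence in probability to 0. *)
Definition cvg_probability0 (Z : nat -> Omega -> \bar R) : Prop :=
  forall e : R, 0 < e ->
    (fun n => P [set w | (e%:E <= `|Z n w|)%E]) @ \oo --> 0%E.

(** [I] is (a version of) the Ito integral of H over [0, t] with respect to W:
    the limit in probability of integrals of simple processes approximating H
    in L^2([0, t]), in probability. *)
Definition is_ito_integral F W H (t : R) (I : Omega -> R) : Prop :=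
  exists K : nat -> simple_process F t,
    cvg_probability0 (fun n w =>
      \int[lebesgue_measure]_(s in `[0%R, t])
        ((H s w - simple_process_fun (K n) s w) ^+ 2)%:E)%E /\
    cvg_probability0 (fun n w => (simple_integral (K n) W w - I w)%:E).

(** X is a solution, living in ]0, +oo[ at all times, of
    dX = b(X) dt + sigma(X) dW, X_0 = x. *)
Record global_SDE_solution F W (b sigma : R -> R) (x : R) X : Prop :=
  GlobalSDESolution {
  sde_adapted : adapted F X ;
  sde_continuous : ae_continuous_paths X ;
  sde_start : {ae P, forall w, X 0 w = x} ;
  sde_pos : {ae P, forall w, forall t : R, 0 <= t -> 0 < X t w} ;
  sde_eq : forall t : R, 0 <= t ->
    is_ito_integral F W (fun s w => sigma (X s w)) t
      (fun w => X t w - x - \int[lebesgue_measure]_(s in `[0, t]) b (X s w))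
}.

(** With locally Lipschitz coefficients on ]0, +oo[ solutions are pathwise
    unique, so "the solution does not explode" says that a solution exists which
    stays in ]0, +oo[ for all times. *)
Definition non_explosive F W (b sigma : R -> R) : Prop :=
  forall x : R, 0 < x -> exists X, global_SDE_solution F W b sigma x X.

End stochastic.

(* Main.v *)
(* Differentiating L_X w = 0 and eliminating w by means of the equation itself
   gives L_Y w' = 0, so phi' and psi' are combinations A phit + B psit.
   For phi', B = 0: since psit blows up at +oo while phit stays bounded there,
   B > 0 would make phi' positive and B < 0 would make phi' <= -1 near +oo,
   hence phi negative.  So phi' = phi'(c) phit.
   For psi', A = 0: the function psi - (A / phi'(c)) phi has derivative B psit,
   which is bounded on ]0, c], so it is bounded there, as is psi; but phi is not.
   Convexity and the formula for Ct are then read off phi'' = phi'(c) phit' and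
   psi'' = psi'(c) psit'. *)
Require Import Defs.
From HB Require Import structures.
From mathcomp Require Import all_boot all_order all_algebra.
From mathcomp Require Import all_classical all_reals all_analysis.
From mathcomp Require Import ring lra.

Set Implicit Arguments.
Unset Strict Implicit.
Unset Printing Implicit Defensive.

Import Order.TTheory GRing.Theory Num.Theory.
Import numFieldNormedType.Exports.

Local Open Scope classical_set_scope.
Local Open Scope ring_scope.

(** * Calculus of C^1 functions on the open half-line *)

Section C1_pos_theory.
Context {R : realType}.
Implicit Types f g df : R -> R.

Lemma near_eq_continuous_for f g (x : R) :
  (\forall y \near x, f y = g y) -> {for x, continuous f} ->
  {for x, continuous g}.
Proof.
move=> fg cf; rewrite /prop_for /continuous_at -(nbhs_singleton fg).
exact: cvg_trans (near_eq_cvg fg) cf.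
Qed.

Lemma near_pos (Q : R -> Prop) (x : R) :
  0 < x -> (forall y, 0 < y -> Q y) -> \forall y \near x, Q y.
Proof. by move=> x0 Qpos; near do apply: Qpos; exact: lt_nbhsr.
Unshelve. all: by end_near. Qed.

Lemma C1_pos_derivable f (x : R) : C1_pos f -> 0 < x -> derivable f x 1.
Proof. by move=> fC /fC []. Qed.

Lemma C1_pos_continuous_derive1 f (x : R) :
  C1_pos f -> 0 < x -> {for x, continuous (derive1 f)}.
Proof. by move=> fC /fC []. Qed.

Lemma C1_pos_is_derive f (x : R) :
  C1_pos f -> 0 < x -> is_derive x 1 f (derive1 f x).
Proof.
move=> fC x0; rewrite derive1E.
exact: (derivableP (C1_pos_derivable fC x0)).
Qed.

Lemma C1_pos_continuous f (x : R) : C1_pos f -> 0 < x -> {for x, continuous f}.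
Proof.
move=> fC x0; apply: differentiable_continuous.
exact: (derivable1_diffP _ _).1 (C1_pos_derivable fC x0).
Qed.

(** Since ]0, +oo[ is open, [derive1 f] agrees with [df] near each positive point, so continuity
    transfers whatever happens elsewhere. The closure properties below all go through this
    criterion. *)
Lemma is_derive_C1_pos f df :
  (forall x : R, 0 < x -> is_derive x 1 f (df x)) ->
  (forall x : R, 0 < x -> {for x, continuous df}) -> C1_pos f.
Proof.
move=> fdf cdf x x0; split; first by have [] := fdf x x0.
apply: near_eq_continuous_for (cdf x x0); apply: near_pos => // y y0.
by rewrite derive1E; have [_ ->] := fdf y y0.
Qed.

Lemma eq_pos_derive1 f g (x : R) :
  (forall y : R, 0 < y -> f y = g y) -> 0 < x -> derive1 f x = derive1 g x.
Proof. by move=> fg x0; rewrite !derive1E; apply: near_eq_derive; exact: near_pos. Qed.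

Lemma eq_pos_C1_pos f g :
  (forall x : R, 0 < x -> f x = g x) -> C1_pos f -> C1_pos g.
Proof.
move=> fg fC; apply: (@is_derive_C1_pos _ (derive1 f)) => x x0; last first.
  exact: C1_pos_continuous_derive1 fC x0.
by apply: near_eq_is_derive (C1_pos_is_derive fC x0); exact: near_pos.
Qed.

Lemma C1_pos_cst (a : R) : C1_pos (fun=> a : R).
Proof.
apply: (@is_derive_C1_pos _ (fun=> 0)) => x _; exact: cvg_cst.
Qed.

Lemma C1_posD f g : C1_pos f -> C1_pos g -> C1_pos (fun x => f x + g x).
Proof.
move=> fC gC.
apply: (@is_derive_C1_pos _ (fun x => derive1 f x + derive1 g x)) => x x0.
  by apply: is_deriveD; exact: C1_pos_is_derive.
exact: continuousD (C1_pos_continuous_derive1 fC x0)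
  (C1_pos_continuous_derive1 gC x0).
Qed.

Lemma C1_posM f g : C1_pos f -> C1_pos g -> C1_pos (fun x => f x * g x).
Proof.
move=> fC gC.
apply: (@is_derive_C1_pos _
    (fun x => f x * derive1 g x + g x * derive1 f x)) => x x0.
  by apply: is_deriveM; exact: C1_pos_is_derive.
have [cdf cdg] :=
  (C1_pos_continuous_derive1 fC x0, C1_pos_continuous_derive1 gC x0).
have [cf cg] := (C1_pos_continuous fC x0, C1_pos_continuous gC x0).
exact: continuousD (continuousM cf cdg) (continuousM cg cdf).
Qed.

Lemma C1_posV f :
  (forall x : R, 0 < x -> f x != 0) -> C1_pos f -> C1_pos (fun x => (f x)^-1).
Proof.
move=> f0 fC.
apply: (@is_derive_C1_pos _ (fun x => - (f x) ^- 2 * derive1 f x)) => x x0.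
  have dfx := C1_pos_derivable fC x0; split; first exact: derivableV (f0 _ x0) dfx.
  by rewrite (deriveV (f0 _ x0) dfx) derive1E.
have cf := C1_pos_continuous fC x0.
have cf2 : {for x, continuous (fun y => f y ^+ 2)} by exact: (continuousM cf cf).
have cVf2 : {for x, continuous (fun y => (f y ^+ 2)^-1)}.
  by apply: (continuousV _ cf2); rewrite expf_neq0// f0.
exact: (continuousM (continuousN cVf2) (C1_pos_continuous_derive1 fC x0)).
Qed.

Lemma MVT_pos f (x y : R) : (forall z : R, 0 < z -> derivable f z 1) ->
  0 < x -> x <= y ->
  exists2 z, x <= z <= y & f y - f x = derive1 f z * (y - x).
Proof.
move=> df x0 xy.
have [||z] := @MVT_segment R f (derive1 f) x y xy.
- move=> z; rewrite in_itv/= => /andP[xz _]; rewrite derive1E.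
  exact/derivableP/df/(lt_trans x0).
- apply: derivable_within_continuous => z; rewrite in_itv/= => /andP[xz _].
  exact/df/(lt_le_trans x0).
by rewrite in_itv/=; exists z.
Qed.

Lemma convex_pos_derive2 f : C2_pos f ->
  (forall x : R, 0 < x -> 0 <= derive1 (derive1 f) x) ->
  convex_function (`]0, +oo[%classic : set R) f.
Proof.
move=> [fC dfC] ddf0 t.
have D1 : 'D_1 f = derive1 f by apply/funext => x; rewrite derive1E.
have convex_le (x y : R) (s : {i01 R}) : 0 < x -> x <= y ->
    (f (conv s (x : R^o) (y : R^o)) <= conv s (f x : R^o) (f y))%R.
  move=> x0 xy; have y0 : 0 < y by exact: lt_le_trans xy.
  apply: second_derivative_convex xy.
  - move=> z /andP[xz _]; rewrite D1 -derive1E.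
    by apply: ddf0; exact: lt_trans xz.
  - exact: (cvg_at_left_filter (C1_pos_continuous fC y0)).
  - exact: (cvg_at_right_filter (C1_pos_continuous fC x0)).
  - move=> z; rewrite in_itv/= => /andP[xz _].
    exact: C1_pos_derivable fC (lt_trans x0 xz).
  - move=> z; rewrite in_itv/= => /andP[xz _]; rewrite D1.
    exact: C1_pos_derivable dfC (lt_trans x0 xz).
move=> x y /[!inE]/= /[!in_itv]/= /[!andbT] x0 y0.
(* Swapping the endpoints replaces the weight by its complement, so the ordered case suffices. *)
have [xy|/ltW yx] := leP x y; first exact: convex_le.
by rewrite convC [leRHS]convC; exact: convex_le.
Qed.

End C1_pos_theory.

(** * From L_X w = 0 to L_Y w' = 0 *)

Section derivative_of_solution.
Context {R : realType}.
Variables b sigma r : R -> R.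
Hypotheses (b_C1 : C1_pos b) (sigma_C1 : C1_pos sigma) (r_C1 : C1_pos r).
Hypothesis sigma_gt0 : forall x : R, 0 < x -> 0 < sigma x ^+ 2.
Hypothesis r_gt0 : forall x : R, 0 < x -> 0 < r x.

(** As sigma^2 > 0, the equation can be solved for w'' = (r w - b w') / (sigma^2 / 2), a quotient of
    C^1 functions. This extra regularity is what allows the equation to be differentiated. *)
Lemma Lop_solution_derive2_C1 w :
  Lop_solution b sigma r w -> C1_pos (derive1 (derive1 w)).
Proof.
move=> [[wC dwC] Lw].
(* The quotient is written with sums, products and one inverse only, to match the closure
   properties. *)
apply: (@eq_pos_C1_pos _ (fun x =>
  (r x * w x + -1 * (b x * derive1 w x)) * (2^-1 * (sigma x * sigma x))^-1)).
  move=> x x0; have := Lw x x0; rewrite /Lop.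
  have := sigma_gt0 x0; rewrite expr2 => s0 /eqP; rewrite subr_eq0 => /eqP <-.
  rewrite mulN1r addrK mulrAC divff ?mul1r//.
  by rewrite mulf_neq0 ?invr_neq0 ?pnatr_eq0// gt_eqF.
apply: C1_posM.
  exact: (C1_posD (C1_posM r_C1 wC)
    (C1_posM (C1_pos_cst (-1)) (C1_posM b_C1 dwC))).
apply: C1_posV; last exact: (C1_posM (C1_pos_cst 2^-1) (C1_posM sigma_C1 sigma_C1)).
by move=> x x0; rewrite mulf_neq0 ?invr_neq0 ?pnatr_eq0// -expr2 gt_eqF ?sigma_gt0.
Qed.

Lemma Lop_solution_derive1 w : Lop_solution b sigma r w ->
  Lop_solution (mu_Y b sigma r) sigma (rho_Y b r) (derive1 w).
Proof.
move=> Lsol; have ddwC := Lop_solution_derive2_C1 Lsol.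
case: Lsol => [[wC dwC] Lw]; split=> // x x0.
have dw := C1_pos_is_derive wC x0.
have ddw := C1_pos_is_derive dwC x0.
have dddw := C1_pos_is_derive ddwC x0.
have db := C1_pos_is_derive b_C1 x0.
have ds := C1_pos_is_derive sigma_C1 x0.
have dr := C1_pos_is_derive r_C1 x0.
have dhalf : is_derive x 1 (cst (2^-1 : R)) (0 : R) by exact: is_derive_cst.
have dL := is_deriveB (is_deriveD
  (is_deriveM (is_deriveM dhalf (is_deriveM ds ds)) dddw)
  (is_deriveM db ddw)) (is_deriveM dr dw).
have dL0 : is_derive x 1 (Lop b sigma r w) (0 : R).
  apply: near_eq_is_derive (is_derive_cst (0 : R) x 1).
  by apply: near_pos => // y y0; rewrite Lw.
(* Two values of the same derivative: the one given by the product rule, and 0 because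
   [Lop b sigma r w] vanishes near x. *)
have L'0 :=
  etrans (esym (@derive_val _ _ _ _ _ _ _ dL)) (@derive_val _ _ _ _ _ _ _ dL0).
have rx0 : r x != 0 by rewrite gt_eqF ?r_gt0.
move: (Lw x x0) L'0; rewrite /Lop /mu_Y /rho_Y /GRing.scale/= !fctE => L0 L'0.
(* L_Y w' = (L_X w)' - (r' / r) L_X w *)
have := congr2 (fun p q => p - derive1 r x / r x * q) L'0 L0.
rewrite [in RHS]mulr0 [in RHS]subr0 => <-.
by field.
Qed.


End derivative_of_solution.

(** * Growth arguments that force a coefficient to vanish *)

Section growth.
Context {R : realType}.
Implicit Types f g u v : R -> R.

Lemma ler0_derive1_pos f (x y : R) : (forall z : R, 0 < z -> derivable f z 1) ->
  (forall z : R, 0 < z -> derive1 f z <= 0) -> 0 < x -> x <= y -> f y <= f x.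
Proof.
move=> df df0 x0 xy; have [z /andP[xz _] fE] := MVT_pos df x0 xy.
rewrite -subr_le0 fE mulr_le0_ge0 ?subr_ge0//.
by rewrite df0// (lt_le_trans x0).
Qed.

Lemma ger0_derive1_pos f (x y : R) : (forall z : R, 0 < z -> derivable f z 1) ->
  (forall z : R, 0 < z -> 0 <= derive1 f z) -> 0 < x -> x <= y -> f x <= f y.
Proof.
move=> df df0 x0 xy; have [z /andP[xz _] fE] := MVT_pos df x0 xy.
rewrite -subr_ge0 fE mulr_ge0 ?subr_ge0//.
by rewrite df0// (lt_le_trans x0).
Qed.

(** If B were nonzero, the term B v would dominate A u far out and f' would take the sign of B
    there: B > 0 contradicts f' < 0, and B < 0 drives f below 0. *)
Lemma decreasing_pos_coef_eq0 f u v (A B c M : R) :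
  (forall x : R, 0 < x -> derivable f x 1) ->
  (forall x : R, 0 < x -> 0 < f x) ->
  (forall x : R, 0 < x -> derive1 f x < 0) ->
  (forall x : R, 0 < x -> derive1 f x = A * u x + B * v x) ->
  (forall x : R, c <= x -> `|u x| <= M) -> v x @[x --> +oo] --> +oo -> B = 0.
Proof.
move=> df f0 f'0 f'E uM v_oo; apply/eqP; apply: contraT => B0.
(* The threshold makes [|B| * v] exceed the bound [|A| * M] on [|A * u|] by at least 1. *)
have /cvgryPge/(_ ((`|A| * M + 1) / `|B|)) [N [_ vN]] := v_oo.
(* Beyond c for the bound on u, at least 1 to be positive, and N + 1 because the bound on v holds
   only strictly beyond N. *)
set a := Num.max (Num.max c 1) (N + 1).
have [ca a1 Na] : [/\ c <= a, 1 <= a & N < a].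
  by rewrite !le_max !lt_max !lexx ltrDl ltr01 !orbT.
have a0 : 0 < a by exact: lt_le_trans a1.
have Bv x : a <= x -> `|A * u x| + 1 <= `|B| * v x.
  move=> ax; have := vN x (lt_le_trans Na ax).
  rewrite /= ler_pdivrMr ?normr_gt0// [v x * _]mulrC; apply: le_trans.
  by rewrite lerD2r normrM ler_wpM2l// uM// (le_trans ca).
have [Bn|Bp] : B < 0 \/ 0 < B by move: B0; rewrite neq_lt => /orP[]; [left|right].
  have f'1 x : a <= x -> derive1 f x <= -1.
    move=> ax; have := Bv x ax; rewrite (ltr0_norm Bn).
    rewrite f'E ?(lt_le_trans a0)//.
    have := ler_norm (A * u x); lra.
  (* The interval has length [f a]: a slope of at most -1 across it gives [f (a + f a) <= 0]. *)
  have [|z /andP[az _] fE] := @MVT_pos R f a (a + f a) df a0.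
    by rewrite lerDl ltW// f0.
  have fa0 := f0 a a0.
  have := f0 (a + f a) (addr_gt0 a0 fa0); have := f'1 z az.
  move: fE; rewrite addrAC subrr add0r => fE; nra.
have := Bv a (lexx _); rewrite (gtr0_norm Bp).
have := f'0 a a0; rewrite f'E//.
have := ler_norm (- (A * u a)); rewrite normrN; lra.
Qed.

(** A bounded derivative on the bounded interval ]0, c] keeps g - k f bounded there; so k f is
    bounded as g is, while f blows up at 0. *)
Lemma bounded_near0_coef_eq0 f g (k c M N : R) : 0 < c ->
  (forall x : R, 0 < x -> derivable f x 1) ->
  (forall x : R, 0 < x -> derivable g x 1) ->
  (forall x : R, 0 < x -> x <= c -> `|g x| <= N) ->
  (forall x : R, 0 < x -> x <= c -> `|derive1 g x - k * derive1 f x| <= M) ->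
  f x @[x --> 0^'+] --> +oo -> k = 0.
Proof.
move=> c0 df dg gN hM f_oo; apply/eqP; apply: contraT => k0.
have dh (x : R) : 0 < x -> is_derive x 1 (g - k \*: f) (derive1 g x - k * derive1 f x).
  move=> x0; rewrite !derive1E.
  exact: (is_deriveB (derivableP (dg x x0)) (is_deriveZ k (derivableP (df x x0)))).
(* Mean value theorem for g - k f on [x, c]: the two N bound g at x and at c, and M * c bounds the
   increment. *)
have kf (x : R) : 0 < x -> x <= c -> `|k| * f x <= `|k * f c| + N + N + M * c.
  move=> x0 xc; have dh' z (z0 : 0 < z) : derivable (g - k \*: f) z 1.
    by have [] := dh z z0.
  have [z /andP[xz zc]] := MVT_pos dh' x0 xc.
  have z0 := lt_le_trans x0 xz.
  rewrite derive1E (@derive_val _ _ _ _ _ _ _ (dh z z0)) !fctE => hE.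
  have hE' : g c - k * f c - (g x - k * f x) =
    (derive1 g z - k * derive1 f z) * (c - x) by exact: hE.
  have kfxE : k * f x =
      (derive1 g z - k * derive1 f z) * (c - x) - g c + k * f c + g x.
    by rewrite -hE'; ring.
  apply: (@le_trans _ _ `|k * f x|).
    by rewrite normrM ler_wpM2l// ler_norm.
  rewrite kfxE; apply: le_trans (ler_normD _ _) _.
  have := ler_normD ((derive1 g z - k * derive1 f z) * (c - x) - g c) (k * f c).
  have := ler_normB ((derive1 g z - k * derive1 f z) * (c - x)) (g c).
  have : `|(derive1 g z - k * derive1 f z) * (c - x)| <= M * c.
    rewrite normrM ler_pM ?hM// ger0_norm ?subr_ge0//.
    by rewrite gerBl ltW.
  have := gN x x0 xc; have := gN c c0 (lexx _); lra.
set K := `|k * f c| + N + N + M * c in kf.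
have /cvgryPgt/(_ (K / `|k|)) fK := f_oo.
have [x [x0 xc fx]] : exists x, [/\ 0 < x, x <= c & K / `|k| < f x].
  apply: (@filter_ex _ (0 : R)^'+); near=> x; split.
  - by near: x; exact: nbhs_right_gt.
  - by near: x; exact: nbhs_right_ltW.
  - by near: x.
have := kf x x0 xc; rewrite leNgt mulrC -ltr_pdivrMr ?normr_gt0//.
by rewrite fx.
Unshelve. all: by end_near. Qed.

End growth.

(** * Identification of the derivatives, convexity, and the relation between C and Ct *)

Theorem proposition2 (R : realType) (d : measure_display)
    (Omega : measurableType d) (P : probability Omega R)
    (F : R -> set (set Omega)) (W : R -> Omega -> R)
    (hF : filtration_usual_conditions P F) (hW : brownian_motion P F W)
    (b sigma r : R -> R) (r0 : R)
    (b_C1 : C1_pos b) (sigma_C1 : C1_pos sigma)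
    (dsigma_lip : locally_lipschitz_pos (derive1 sigma))
    (sigma_gt0 : forall x : R, 0 < x -> 0 < sigma x ^+ 2)
    (X_non_explosive : non_explosive P F W b sigma)
    (r_C1 : C1_pos r) (dr_lip : locally_lipschitz_pos (derive1 r))
    (r0_gt0 : 0 < r0) (r_ge : forall x : R, 0 < x -> r0 <= r x)
    (Y_non_explosive : non_explosive P F W (mu_Y b sigma r) sigma)
    (rho_ge : forall x : R, 0 < x -> r0 <= rho_Y b r x)
    (c : R) (c_gt0 : 0 < c)
    (phi psi phit psit : R -> R)
    (hX : fundamental_pair b sigma r c phi psi)
    (hY : fundamental_pair (mu_Y b sigma r) sigma (rho_Y b r) c phit psit) :
  [/\ forall x : R, 0 < x ->
        phit x = 1 / derive1 phi c * derive1 phi x /\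
        psit x = 1 / derive1 psi c * derive1 psi x,
      convex_function (`]0, +oo[%classic : set R) phi,
      convex_function (`]0, +oo[%classic : set R) psi &
      let C := derive1 psi c - derive1 phi c in
      let Ct := derive1 psit c - derive1 phit c in
      Ct = - (2 * r c / sigma c ^+ 2) * (1 / (derive1 phi c * derive1 psi c)) * C].
Proof.
have r_gt0 x : 0 < x -> 0 < r x by move=> x0; exact: lt_le_trans (r_ge x x0).
have dsol := Lop_solution_derive1 b_C1 sigma_C1 r_C1 sigma_gt0 r_gt0.
case: hX => phiS psiS _ phi0 dphi0 psi0 dpsi0 phi_oo psi_oo phic psic.
case: hY => phitS psitS spanY phit0 dphit0 psit0 dpsit0 phit_oo psit_oo phitc psitc.
have [[phiC dphiC] Lphi] := phiS; have [[psiC dpsiC] Lpsi] := psiS.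
have [[phitC _] _] := phitS; have [[psitC _] _] := psitS.
have dphi x (x0 : 0 < x) := C1_pos_derivable phiC x0.
have dpsi x (x0 : 0 < x) := C1_pos_derivable psiC x0.
have dphit x (x0 : 0 < x) := C1_pos_derivable phitC x0.
have dpsit x (x0 : 0 < x) := C1_pos_derivable psitC x0.
have phic0 : derive1 phi c != 0 by rewrite lt_eqF ?dphi0.
have psic0 : derive1 psi c != 0 by rewrite gt_eqF ?dpsi0.
have phiE x : 0 < x -> derive1 phi x = derive1 phi c * phit x.
  have [A [B ABE]] := spanY _ (dsol _ phiS).
  have B0 : B = 0.
    (* The bound 1 is [phit c], as [phit] is positive and decreasing. Once B = 0, evaluating at c
       gives A = phi'(c). *)
    apply: (decreasing_pos_coef_eq0 (M := 1) dphi phi0 dphi0 ABE _ psit_oo) => y cy.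
    have y0 := lt_le_trans c_gt0 cy.
    rewrite gtr0_norm ?phit0// -phitc (ler0_derive1_pos dphit _ c_gt0 cy)//.
    by move=> z /dphit0 /ltW.
  by move=> x0; rewrite !ABE// B0 phitc mulr1 !mul0r !addr0.
have psiE x : 0 < x -> derive1 psi x = derive1 psi c * psit x.
  have [A [B ABE]] := spanY _ (dsol _ psiS).
  (* By [phiE], A phit = k phi' for this quotient k, so psi' - k phi' = B psit. On ]0, c] both [psi]
     and [psit] lie between 0 and their value 1 at c, whence the bounds 1 and [|B|]. *)
  have k0 : A / derive1 phi c = 0.
    apply: (bounded_near0_coef_eq0 (M := `|B|) (N := 1) c_gt0 dphi dpsi _ _ phi_oo)
      => y y0 yc.
      rewrite gtr0_norm ?psi0// -psic (ger0_derive1_pos dpsi _ y0 yc)//.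
      by move=> z /dpsi0 /ltW.
    rewrite ABE// (phiE y)// mulrA divfK// addrAC subrr add0r normrM.
    rewrite ler_piMr// gtr0_norm ?psit0// -psitc.
    by rewrite (ger0_derive1_pos dpsit _ y0 yc)// => z /dpsit0 /ltW.
  have A0 : A = 0 by rewrite -(divfK phic0 A) k0 mul0r.
  by move=> x0; rewrite !ABE// A0 psitc mulr1 !mul0r !add0r.
have ddphiE x : 0 < x -> derive1 (derive1 phi) x = derive1 phi c * derive1 phit x.
  by move=> x0; rewrite (eq_pos_derive1 phiE x0) derive1Ml//; exact: dphit.
have ddpsiE x : 0 < x -> derive1 (derive1 psi) x = derive1 psi c * derive1 psit x.
  by move=> x0; rewrite (eq_pos_derive1 psiE x0) derive1Ml//; exact: dpsit.
split.
- by move=> x x0; rewrite (phiE x)// (psiE x)// !mul1r !mulKf.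
- apply: convex_pos_derive2 => [|x x0]; first by case: phiS.
  (* Both factors of phi'' = phi'(c) phit' are negative. *)
  by rewrite ddphiE// mulr_le0 ?ltW// ?dphi0 ?dphit0.
- apply: convex_pos_derive2 => [|x x0]; first by case: psiS.
  by rewrite ddpsiE// mulr_ge0 ?ltW// ?dpsi0 ?dpsit0.
- move: (Lphi c c_gt0) (Lpsi c c_gt0); rewrite /Lop ddphiE// ddpsiE// phic psic.
  have sc0 : sigma c != 0.
    by have := sigma_gt0 c c_gt0; apply: contraTneq => ->; rewrite expr0n ltxx.
  move: (derive1 phi c) (derive1 psi c) (derive1 phit c) (derive1 psit c)
    phic0 psic0 => p q pt qt p0 q0 Lp Lq /=.
  (* The equation at c for [phi] or [psi], with m the first derivative there, m * mt the second, and
     1 the normalised value. Solved for mt it reads 2 r / (sigma^2 m) - 2 b / sigma^2, so the b term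
     cancels in Ct. *)
  have solve_t (m mt : R) : m != 0 ->
      2^-1 * sigma c ^+ 2 * (m * mt) + b c * m - r c * 1 = 0 ->
      mt = (r c - b c * m) * (2 / (sigma c ^+ 2 * m)).
    move=> m0 Lm; have -> : r c - b c * m = 2^-1 * sigma c ^+ 2 * (m * mt) by lra.
    by field; rewrite m0.
  by rewrite (solve_t p pt)// (solve_t q qt)//; field; rewrite p0 q0.
Qed.
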